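(* Let $k$ be a field, $n\ge 1$ an integer, $X=\{x_0,\dots,x_n\}$. Let $R$ be a local $k$-subalgebra of $k\langle\langle X\rangle\rangle$ containing $k\langle X\rangle$ and invariant under the maps $\delta_0,\dots,\delta_n$. Let $f:R\to R^{n+1}$ be the right $R$-module homomorphism given by left multiplication by the column $(x_0,\dots,x_n)^T$, and let $T=R_f$ be the universal localization of $R$ with respect to $f$. Then $K_0(T)$ is a cyclic group of order $n$, generated by $[T]$.
   Context: All rings are unital. $k\langle X\rangle$ is the free $k$-algebra and $k\langle\langle X\rangle\rangle$ the algebra of noncommutative formal power series $\sum_{w\in X^*}\lambda_w w$ ($\lambda_w\in k$), where $X^*$ is the free monoid on $X$. The $k$-linear maps $\delta_i$ are defined by $\delta_i\bigl(\sum_w\lambda_w w\bigr)=\sum_w\lambda_{wx_i}w$. The universal localization $R\to R_f$ is the universal ring homomorphism from $R$ such that $f\otimes_R 1_{R_f}$ becomes invertible. (In the paper $T$ is also described as $S/SeS$, where $S=R\langle Y;\tau,\delta\rangle$ is the skew polynomial ring on $Y=\{y_0,\dots,y_n\}$ in which $ry_i=y_i\tau(r)+\delta_i(r)$, with $\tau(r)$ the constant term of $r$, and $e=1-\sum_{i=0}^n y_ix_i$; this is isomorphic to $R_f$.) *)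

(* Defs.v *)
From HB Require Import structures.
From mathcomp Require Import all_boot all_order all_algebra.
From mathcomp Require Import boolp functions.

Set Implicit Arguments.
Unset Strict Implicit.
Unset Printing Implicit Defensive.

Import GRing.Theory.
Local Open Scope ring_scope.

(* Noncommutative formal power series: the series \sum_w (s w) w over the     *)
(* free monoid [seq X] is represented by its coefficient function s.          *)

Definition ncps (k : fieldType) (X : eqType) : Type := seq X -> k.

Section NCPS.
Variables (k : fieldType) (X : eqType).
Local Notation A := (ncps k X).

HB.instance Definition _ := Choice.copy A (seq X -> k).
HB.instance Definition _ := GRing.Zmodule.copy A (seq X -> k).

Definition ncps_scale (a : k) (s : A) : A := fun w => a * s w.

Definition ncps_one : A := fun w => (w == [::])%:R.

(* w = take i w ++ drop i w runs over all factorizations of the word w *)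
Definition ncps_mul (s t : A) : A :=
  fun w => \sum_(i < (size w).+1) s (take i w) * t (drop i w).

Lemma ncpsP (s t : A) : s =1 t -> s = t.
Proof. exact: funext. Qed.

Lemma ncps_addE (s t : A) w : (s + t) w = s w + t w.
Proof. by []. Qed.

Lemma ncps_scaleA a b s : ncps_scale a (ncps_scale b s) = ncps_scale (a * b) s.
Proof. by apply: ncpsP => w; rewrite /ncps_scale mulrA. Qed.

Lemma ncps_scale1 : left_id 1 ncps_scale.
Proof. by move=> s; apply: ncpsP => w; rewrite /ncps_scale mul1r. Qed.

Lemma ncps_scaleDr : right_distributive ncps_scale +%R.
Proof.
by move=> a s t; apply: ncpsP => w; rewrite ncps_addE /ncps_scale mulrDr.
Qed.

Lemma ncps_scaleDl s : {morph ncps_scale^~ s : a b / a + b}.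
Proof.
by move=> a b; apply: ncpsP => w; rewrite ncps_addE /ncps_scale mulrDl.
Qed.

HB.instance Definition _ := GRing.Zmodule_isLmodule.Build k A
  ncps_scaleA ncps_scale1 ncps_scaleDr ncps_scaleDl.

Lemma ncps_mulDl : left_distributive ncps_mul +%R.
Proof.
move=> s t u; apply: ncpsP => w; rewrite ncps_addE -big_split.
by apply: eq_bigr => i _; rewrite ncps_addE mulrDl.
Qed.

Lemma ncps_mulDr : right_distributive ncps_mul +%R.
Proof.
move=> s t u; apply: ncpsP => w; rewrite ncps_addE -big_split.
by apply: eq_bigr => i _; rewrite ncps_addE mulrDr.
Qed.

Lemma ncps_scalerAl a s t : a *: ncps_mul s t = ncps_mul (a *: s) t.
Proof.
apply: ncpsP => w; rewrite [LHS]mulr_sumr.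
by apply: eq_bigr => i _; rewrite mulrA.
Qed.

Lemma ncps_scalerAr a s t : a *: ncps_mul s t = ncps_mul s (a *: t).
Proof.
apply: ncpsP => w; rewrite [LHS]mulr_sumr.
by apply: eq_bigr => i _; rewrite mulrCA.
Qed.

Let tl x (s : A) : A := fun w => s (x :: w).

Lemma ncps_mul_nil s t : ncps_mul s t [::] = s [::] * t [::].
Proof. by rewrite /ncps_mul big_ord1. Qed.

Lemma ncps_mul_cons s t x w :
  ncps_mul s t (x :: w) = s [::] * t (x :: w) + ncps_mul (tl x s) t w.
Proof. by rewrite /ncps_mul big_ord_recl. Qed.

Lemma ncps_mulA : associative ncps_mul.
Proof.
move=> s t u; apply: ncpsP => w.
elim: w s => [|x w IHw] s; first by rewrite !ncps_mul_nil mulrA.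
rewrite !ncps_mul_cons ncps_mul_nil IHw mulrDr mulrA -addrA; congr (_ + _).
have -> : tl x (ncps_mul s t) = s [::] *: tl x t + ncps_mul (tl x s) t.
  by apply: ncpsP => v; rewrite /tl ncps_mul_cons.
by rewrite ncps_mulDl -ncps_scalerAl.
Qed.

Lemma ncps_mul1 : left_id ncps_one ncps_mul.
Proof.
move=> s; apply: ncpsP => w.
rewrite /ncps_mul big_ord_recl take0 drop0 /ncps_one eqxx mul1r big1 ?addr0 //.
by case: w => [|x w] [i lti] //= _; rewrite mul0r.
Qed.

Lemma ncps_mulr1 : right_id ncps_one ncps_mul.
Proof.
move=> s; apply: ncpsP => w.
rewrite /ncps_mul big_ord_recr /= take_size drop_size /ncps_one eqxx mulr1.
rewrite big1 ?add0r // => i _.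
by rewrite -size_eq0 size_drop subn_eq0 leqNgt ltn_ord mulr0.
Qed.

Lemma ncps_one_neq0 : ncps_one != 0.
Proof. by apply/eqP => /(congr1 (@^~ [::])) /eqP; rewrite /= oner_eq0. Qed.

HB.instance Definition _ := GRing.Zmodule_isNzRing.Build A
  ncps_mulA ncps_mul1 ncps_mulr1 ncps_mulDl ncps_mulDr ncps_one_neq0.

HB.instance Definition _ := GRing.Lmodule_isLalgebra.Build k A ncps_scalerAl.

HB.instance Definition _ := GRing.Lalgebra_isAlgebra.Build k A ncps_scalerAr.

Definition ncvar (x : X) : A := fun w => (w == [:: x])%:R.

(* membership in the free algebra k<X>: finite support *)
Definition is_ncpoly (s : A) : Prop :=
  exists L : seq (seq X), forall w, s w != 0 -> w \in L.

(* the coefficient of w in delta_x (\sum_v (s v) v) is that of w x in s *)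
Definition ncdelta (x : X) (s : A) : A := fun w => s (rcons w x).

End NCPS.

Section Rings.

Definition is_unit (R : pzRingType) (a : R) : Prop :=
  exists b, a * b = 1 /\ b * a = 1.

(* The non-units form a two-sided ideal. *)
Definition local_ring (R : pzRingType) : Prop :=
  [/\ ~ is_unit (0 : R),
      forall a b : R, ~ is_unit a -> ~ is_unit b -> ~ is_unit (a + b),
      forall a b : R, ~ is_unit a -> ~ is_unit (b * a)
    & forall a b : R, ~ is_unit a -> ~ is_unit (a * b)].

(* M : 'M[R]_(m, p) is the homomorphism R^p -> R^m of right R-modules given   *)
(* by left multiplication by M; its base change M (x)_R 1_T along phi is left *)
(* multiplication by map_mx phi M.                                            *)
Definition inverts (R T : pzRingType) (m p : nat) (M : 'M[R]_(m, p))
    (phi : {rmorphism R -> T}) : Prop :=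
  bijective (fun v : 'cV[T]_p => map_mx phi M *m v).

Definition is_universal_localization (R T : pzRingType) (m p : nat)
    (M : 'M[R]_(m, p)) (phi : {rmorphism R -> T}) : Prop :=
  inverts M phi /\
  forall (S : pzRingType) (psi : {rmorphism R -> S}), inverts M psi ->
    exists theta : {rmorphism T -> S}, theta \o phi =1 psi /\
      forall theta' : {rmorphism T -> S}, theta' \o phi =1 psi ->
        theta' =1 theta.

End Rings.

(* Grothendieck group of finitely generated projective left A-modules; right  *)
(* T-modules are obtained as left modules over the converse ring A = T^c.     *)
Section K0.
Variable A : pzRingType.

Definition finitely_generated (P : lmodType A) : Prop :=
  exists (m : nat) (g : 'I_m -> P),
    forall v, exists c : 'I_m -> A, v = \sum_i c i *: g i.

Definition projective (P : lmodType A) : Prop :=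
  forall (M N : lmodType A) (p : {linear M -> N}) (f : {linear P -> N}),
    (forall y, exists x, p x = y) ->
    exists g : {linear P -> M}, p \o g =1 f.

Definition lmod_isomorphic (P Q : lmodType A) : Prop :=
  exists f : {linear P -> Q}, bijective f.

Record fgProj := FgProj {
  fgProj_mod :> lmodType A;
  fgProj_fg : finitely_generated fgProj_mod;
  fgProj_proj : projective fgProj_mod
}.

Lemma regular_fg : finitely_generated A^o.
Proof.
by exists 1%N, (fun=> 1) => v; exists (fun=> v); rewrite big_ord1 [RHS]mulr1.
Qed.

Lemma regular_projective : projective A^o.
Proof.
move=> M N p f /(_ (f 1))[x px].
have lin : linear (fun a : A^o => a *: x).
  by move=> a u v; rewrite scalerDl -scalerA.
pose gM := GRing.isLinear.Build A A^o M *:%R (fun a : A^o => a *: x) lin.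
pose g : {linear A^o -> M} := HB.pack (fun a : A^o => a *: x) gM.
exists g => a; rewrite /= linearZ_LR px /=.
have f1 : f ((a : A) *: (1 : A^o)) = (a : A) *: f 1 by rewrite linearZ_LR.
by rewrite -f1; congr (f _); exact: mulr1.
Qed.

Definition fgProj_regular : fgProj := FgProj regular_fg regular_projective.

(* cls is constant on isomorphism classes and additive on direct sums *)
Definition additive_invariant (G : zmodType) (cls : fgProj -> G) : Prop :=
  (forall P Q : fgProj, lmod_isomorphic P Q -> cls P = cls Q) /\
  (forall P Q S : fgProj, lmod_isomorphic S (P * Q)%type ->
     cls S = cls P + cls Q).

(* (G, cls) is the group completion of the monoid of isomorphism classes of   *)
(* finitely generated projective modules, cls P being the class [P].          *)
Definition is_K0 (G : zmodType) (cls : fgProj -> G) : Prop :=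
  additive_invariant cls /\
  forall (H : zmodType) (h : fgProj -> H), additive_invariant h ->
    exists theta : {additive G -> H}, theta \o cls =1 h /\
      forall theta' : {additive G -> H}, theta' \o cls =1 h ->
        theta' =1 theta.

End K0.

Definition cyclic_of_order_generated_by (G : zmodType) (n : nat) (g : G) : Prop :=
  (forall x : G, exists j : int, x = g *~ j) /\
  (exists h : 'I_n -> G, bijective h).

(* Main.v *)
Require Import Defs.
From HB Require Import structures.
From mathcomp Require Import all_boot all_order all_fingroup all_algebra.
From mathcomp Require Import boolp functions.
From mathcomp Require Import zify.

Set Implicit Arguments.
Unset Strict Implicit.
Unset Printing Implicit Defensive.

Import GRing.Theory.
Local Open Scope ring_scope.

(** The column (x_i) is invertible over T exactly when there are elements y_j
    of T with x_i y_j = delta_ij and \sum_i y_i x_i = 1, so T is isomorphic to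
    T^(n+1) as a module and n [T] = 0.  The theorem says that this is the only
    relation and that [T] generates; both follow from one normal form for
    matrices.

    Rank factorization ([rank_factored_all]).  Every matrix M over T is C B
    where C is the inclusion and B the projection of a free direct summand of
    rank r, the two complements being free, and the sizes of M are congruent
    modulo n to r plus the ranks of these complements.  Indeed, let X_m be the
    invertible n.+1 m by m matrix made of n.+1 scalar blocks x_i 1_m.  Its two
    sizes agree modulo n, so multiplying by X_m or by its inverse is harmless.
    - For t in T there is l such that x_w t lies in the image of R for all words
      w of length l: these t form a subring ([leveled_subring_closed]) over
      which the column is already invertible, hence it is all of T by
      universality.  Multiplying M on the left by l matrices X_m therefore
      brings it into the image of R.
    - Over R, if some entry has a nonzero constant term, it is a unit because R
      is local, and a pivot step removes one row and one column.  If no entry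
      has one, then M = N X_p where the entries of N are the delta_i of those of
      M.  The number of rows does not change, and a word of the support of
      an entry gets shorter, so a pivot appears unless M = 0.

    Generation.  A finitely generated projective module is the image of an
    idempotent matrix E = C B, and then B C = 1, so that it is free
    ([fgProj_free]).

    Order.  If M is invertible, both complements vanish, provided that 1 <> 0 in
    T; hence T^a and T^b are isomorphic only if a = b modulo n
    ([rank_factored_invertible]), and the rank modulo n is an additive invariant
    inverse to i |-> i [T] ([K0_cyclic]).

    Nontriviality.  By universality, T is nonzero as soon as R maps to some
    nonzero ring where the column becomes invertible.  Such a ring is given by
    the endomorphisms of a space of functions on which all power series act
    ([localization_nontrivial]). *)

(** * The ring of additive endomorphisms *)
Section EndomorphismRing.
Variable V : zmodType.

Definition additive_fun : pred (V -> V) :=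
  fun f => `[< zmod_morphism f >].

Lemma additive_funP (f : V -> V) :
  reflect (zmod_morphism f) (f \in additive_fun).
Proof. exact: asboolP. Qed.

Lemma additive_fun_zmod_closed : zmod_closed additive_fun.
Proof.
split=> [|f g /additive_funP fB /additive_funP gB]; apply/additive_funP => u v.
  by rewrite subr0.
have E (a b : V -> V) w : (a - b) w = a w - b w by [].
by rewrite !E fB gB !opprD !opprK addrACA.
Qed.

HB.instance Definition _ :=
  GRing.isZmodClosed.Build (V -> V) additive_fun additive_fun_zmod_closed.

Record endo := Endo { endo_fun :> V -> V; _ : endo_fun \in additive_fun }.

HB.instance Definition _ := [isSub for endo_fun].
HB.instance Definition _ := [Choice of endo by <:].
HB.instance Definition _ := [SubChoice_isSubZmodule of endo by <:].

Lemma endoB (f : endo) : zmod_morphism f.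
Proof. exact/additive_funP/valP. Qed.

Lemma endoP (f g : endo) : (forall v, f v = g v) -> f = g.
Proof. by move=> fg; apply/val_inj/funext. Qed.

Lemma endoD (f : endo) : {morph f : u v / u + v}.
Proof.
have f0 : f 0 = 0 by rewrite -[0 in LHS](subr0 0) endoB subrr.
have fN v : f (- v) = - f v by rewrite -sub0r endoB f0 sub0r.
by move=> u v; rewrite -[v in LHS]opprK endoB fN opprK.
Qed.

Lemma endo_one_subproof : (id : V -> V) \in additive_fun.
Proof. exact/additive_funP. Qed.

Lemma endo_mul_subproof (f g : endo) : f \o g \in additive_fun.
Proof. by apply/additive_funP => u v; rewrite /= !endoB. Qed.

Definition endo_one : endo := Endo endo_one_subproof.
Definition endo_mul (f g : endo) : endo := Endo (endo_mul_subproof f g).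

Fact endo_mulA : associative endo_mul.
Proof. by move=> f g h; apply: endoP. Qed.
Fact endo_mul1 : left_id endo_one endo_mul.
Proof. by move=> f; apply: endoP. Qed.
Fact endo_mulr1 : right_id endo_one endo_mul.
Proof. by move=> f; apply: endoP. Qed.
Fact endo_mulDl : left_distributive endo_mul +%R.
Proof. by move=> f g h; apply: endoP. Qed.
Fact endo_mulDr : right_distributive endo_mul +%R.
Proof. by move=> f g h; apply: endoP => v; rewrite /= endoD. Qed.

HB.instance Definition _ := GRing.Zmodule_isPzRing.Build endo
  endo_mulA endo_mul1 endo_mulr1 endo_mulDl endo_mulDr.

Lemma endo_mulE (f g : endo) v : (f * g) v = f (g v).
Proof. by []. Qed.

Lemma endo_sumE I (r : seq I) (F : I -> endo) v :
  (\sum_(i <- r) F i : endo) v = \sum_(i <- r) (F i) v.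
Proof. by elim/big_ind2: _ => // f u g w /= <- <-. Qed.

Definition to_endo (f : V -> V) (fB : zmod_morphism f) : endo :=
  Endo (introT (additive_funP f) fB).

End EndomorphismRing.

(** * A module over power series with an invertible column of variables *)
Section SeriesAction.
Variables (k : fieldType) (n : nat).
Local Notation A := (ncps k 'I_n.+1).
Local Notation node := (int * nat)%type.

(** The set of nodes is a disjoint union of n.+1 copies of itself, copy i being
    embedded by [child i]; the second component only serves as a set of base
    n.+1 expansions.  The first component counts levels: it makes the sum over
    all words in the action of a series finite, as words of length l move up by
    l levels and the functions acted on vanish on high levels. *)
Definition child (i : 'I_n.+1) (o : node) : node :=
  (o.1 + 1, (o.2 * n.+1 + i)%N).

Definition parent (o : node) : node := (o.1 - 1, (o.2 %/ n.+1)%N).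

Definition digit (o : node) : 'I_n.+1 := inord (o.2 %% n.+1).

Lemma digit_child i o : digit (child i o) = i.
Proof. by rewrite /digit /= modnMDl modn_small // inord_val. Qed.

Lemma parent_child i o : parent (child i o) = o.
Proof.
by case: o => a b; rewrite /parent /= addrK divnMDl // divn_small // addn0.
Qed.

Lemma child_parent o : child (digit o) (parent o) = o.
Proof.
case: o => a b; rewrite /child /digit /= subrK inordK ?ltn_pmod //.
by rewrite -divn_eq.
Qed.

Definition vanishes_from (f : node -> k) (N : nat) : Prop :=
  forall o : node, N%:Z <= o.1 -> f o = 0.

Definition bounded_level : pred (node -> k) :=
  fun f => `[< exists N, vanishes_from f N >].

Lemma bounded_levelP (f : node -> k) :
  reflect (exists N, vanishes_from f N) (f \in bounded_level).
Proof. exact: asboolP. Qed.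

Lemma vanishes_from_le f N N' :
  (N <= N')%N -> vanishes_from f N -> vanishes_from f N'.
Proof. by move=> NN' fN o No; apply: fN; lia. Qed.

Lemma bounded_level_zmod_closed : zmod_closed bounded_level.
Proof.
split=> [|f g /bounded_levelP[N fN] /bounded_levelP[N' gN']].
  by apply/bounded_levelP; exists 0%N.
apply/bounded_levelP; exists (maxn N N') => o No.
have -> : (f - g) o = f o - g o by [].
by rewrite fN ?gN' ?subrr //; lia.
Qed.

HB.instance Definition _ := GRing.isZmodClosed.Build (node -> k)
  bounded_level bounded_level_zmod_closed.

Record lfun := Lfun { lfun_fun :> node -> k; _ : lfun_fun \in bounded_level }.

HB.instance Definition _ := [isSub for lfun_fun].
HB.instance Definition _ := [Choice of lfun by <:].
HB.instance Definition _ := [SubChoice_isSubZmodule of lfun by <:].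

Lemma lfunP (f g : lfun) : f =1 g -> f = g.
Proof. by move=> fg; apply/val_inj/funext. Qed.

Lemma lfun_bounded (f : lfun) : exists N, vanishes_from f N.
Proof. exact/bounded_levelP/valP. Qed.

Definition to_lfun (f : node -> k) (fN : exists N, vanishes_from f N) : lfun :=
  Lfun (introT (bounded_levelP f) fN).

Definition lstrip (i : 'I_n.+1) (s : A) : A := fun w => s (i :: w).

(** The sum of (s w) (f o_w) over the words w of length less than L, where o_w
    is reached from o by following the letters of w.  Recursion on the first
    letter avoids any summation over words. *)
Fixpoint act_upto (L : nat) (s : A) (f : node -> k) (o : node) : k :=
  if L is L'.+1 then
    s [::] * f o + \sum_(i < n.+1) act_upto L' (lstrip i s) f (child i o)
  else 0.

Lemma actBl L s t f o :
  act_upto L (s - t) f o = act_upto L s f o - act_upto L t f o.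
Proof.
elim: L s t o => [|L IH] s t o /=; first by rewrite subrr.
have -> : (s - t) [::] = s [::] - t [::] by [].
rewrite mulrBl opprD addrACA -sumrB; congr (_ + _).
by apply: eq_bigr => i _; rewrite -IH.
Qed.

Lemma act0l L f o : act_upto L 0 f o = 0.
Proof. by rewrite -[X in act_upto _ X](subrr 0) actBl subrr. Qed.

Lemma actDl L s t f o :
  act_upto L (s + t) f o = act_upto L s f o + act_upto L t f o.
Proof. by rewrite -[t in LHS]opprK actBl -sub0r actBl act0l sub0r opprK. Qed.

Lemma actZl L a s f o : act_upto L (a *: s) f o = a * act_upto L s f o.
Proof.
elim: L s o => [|L IH] s o /=; first by rewrite mulr0.
rewrite mulrDr mulrA mulr_sumr; congr (_ + _).
by apply: eq_bigr => i _; rewrite -IH.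
Qed.

Lemma actBr L s f g o :
  act_upto L s (fun o => f o - g o) o = act_upto L s f o - act_upto L s g o.
Proof.
elim: L s o => [|L IH] s o /=; first by rewrite subrr.
rewrite mulrBr opprD addrACA -sumrB; congr (_ + _).
by apply: eq_bigr => i _; rewrite IH.
Qed.

Lemma act_vanishes L s f N :
  vanishes_from f N -> vanishes_from (act_upto L s f) N.
Proof.
move=> fN; elim: L s => [|L IH] s o No //=.
by rewrite fN // mulr0 add0r big1 // => i _; apply: IH => /=; lia.
Qed.

(** Words that lead above the level where f vanishes contribute nothing, so the
    truncation is irrelevant once it is long enough. *)
Lemma act_stable L L' s f N (o : node) : vanishes_from f N ->
  N%:Z <= o.1 + L%:Z -> N%:Z <= o.1 + L'%:Z ->
  act_upto L s f o = act_upto L' s f o.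
Proof.
move=> fN; elim: L L' s o => [|L IH] [|L'] s o lt1 lt2 //.
- rewrite (act_vanishes L'.+1 s fN) //; lia.
- by rewrite (act_vanishes L.+1 s fN) //; lia.
by rewrite /=; congr (_ + _); apply: eq_bigr => i _; apply: IH => /=; lia.
Qed.

Definition series_act (s : A) (f : lfun) (o : node) : k :=
  let N := projT1 (cid (lfun_bounded f)) in act_upto `|N%:Z - o.1|%N s f o.

Lemma series_actE (s : A) (f : lfun) (o : node) N L :
  vanishes_from f N -> N%:Z <= o.1 + L%:Z ->
  series_act s f o = act_upto L s f o.
Proof.
move=> fN oL; rewrite /series_act; case: cid => N' fN' /=.
rewrite (act_stable (L' := (L + `|N'%:Z - o.1|)%N) _ fN') //; try lia.
by apply: (act_stable _ fN); lia.
Qed.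

Lemma series_act_vanishes s (f : lfun) N :
  vanishes_from f N -> vanishes_from (series_act s f) N.
Proof.
by move=> fN o No; rewrite (series_actE (L := 0) _ fN) //; lia.
Qed.

Lemma series_act_bounded s f : exists N, vanishes_from (series_act s f) N.
Proof. by have [N /series_act_vanishes] := lfun_bounded f; exists N. Qed.

Definition series_lfun s f : lfun := to_lfun (series_act_bounded s f).

Lemma series_lfunB s : zmod_morphism (series_lfun s).
Proof.
move=> f g; apply: lfunP => o.
have -> : (series_lfun s f - series_lfun s g) o =
          series_act s f o - series_act s g o by [].
have [N fN] := lfun_bounded f; have [N' gN] := lfun_bounded g.
pose M := maxn N N'; pose L := `|M%:Z - o.1|%N.
have fM : vanishes_from f M by apply: vanishes_from_le fN; rewrite leq_maxl.
have gM : vanishes_from g M by apply: vanishes_from_le gN; rewrite leq_maxr.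
have fgM : vanishes_from (f - g : lfun) M.
  move=> p Mp; have -> : (f - g : lfun) p = f p - g p by [].
  by rewrite fM // gM // subrr.
have oL : M%:Z <= o.1 + L%:Z by lia.
by rewrite [LHS](series_actE s fgM oL) (series_actE s fM oL)
  (series_actE s gM oL) -actBr.
Qed.

Definition series_endo (s : A) : endo lfun := to_endo (series_lfunB s).

Lemma series_endoE s f o : series_endo s f o = series_act s f o.
Proof. by []. Qed.

Lemma series_endo1 : series_endo 1 = 1.
Proof.
apply: endoP => f; apply: lfunP => o; rewrite series_endoE.
have [N fN] := lfun_bounded f.
rewrite (series_actE (L := `|N%:Z - o.1|.+1%N) _ fN) /=; last by lia.
rewrite [_ [::]](_ : _ = 1) // mul1r big1 ?addr0 // => i _.
by rewrite (_ : lstrip i 1 = 0) ?act0l //; apply: ncpsP.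
Qed.

Lemma series_endoB s t : series_endo (s - t) = series_endo s - series_endo t.
Proof.
apply: endoP => f; apply: lfunP => o.
have -> : (series_endo s - series_endo t : endo lfun) f o =
          series_act s f o - series_act t f o by [].
have [N fN] := lfun_bounded f.
have oL : N%:Z <= o.1 + `|N%:Z - o.1|%N%:Z by lia.
by rewrite series_endoE !(series_actE _ fN oL) actBl.
Qed.

Lemma lstrip_mul i s t :
  lstrip i (s * t) = s [::] *: lstrip i t + lstrip i s * t.
Proof. by apply: ncpsP => w; rewrite ncps_addE /lstrip [LHS]ncps_mul_cons. Qed.

(** Both sides split according to whether the word consumed by s is empty: the
    recursion [lstrip_mul] for products of series matches that of [act_upto]. *)
Lemma series_endoM s t : series_endo (s * t) = series_endo s * series_endo t.
Proof.
apply: endoP => f; apply: lfunP => o; rewrite endo_mulE !series_endoE.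
have [N fN] := lfun_bounded f.
have tN : vanishes_from (series_lfun t f) N := series_act_vanishes t fN.
have oL : N%:Z <= o.1 + `|N%:Z - o.1|%N%:Z by lia.
rewrite (series_actE _ fN oL) (series_actE (f := series_lfun t f) _ tN oL).
move: `|_|%N oL => L; elim: L s o => [|L IH] s o oL //=.
rewrite (series_actE t fN oL) /= [(s * t) _]ncps_mul_nil mulrDr mulrA -addrA.
rewrite mulr_sumr -big_split; congr (_ + _); apply: eq_bigr => i _ /=.
by rewrite lstrip_mul actDl actZl IH //=; lia.
Qed.

Lemma endo_var i f o : series_endo (ncvar k i) f o = f (child i o).
Proof.
have [N fN] := lfun_bounded f.
rewrite series_endoE (series_actE (L := `|N%:Z - o.1|.+2%N) _ fN); last by lia.
rewrite [LHS]/= mul0r add0r (bigD1 i) //=.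
have -> : lstrip i (ncvar k i) [::] = 1 by rewrite /lstrip /ncvar eqxx.
rewrite mul1r big1 => [|j _].
  rewrite addr0 big1 ?addr0 // => j ji.
  have -> : lstrip j (ncvar k i) = 0.
    by apply: ncpsP => w; rewrite /lstrip /ncvar eqseq_cons (negPf ji).
  rewrite [0 _]/(0 : k) mul0r add0r big1 // => l _.
  by rewrite (_ : lstrip l 0 = 0) ?act0l.
rewrite (_ : lstrip j (lstrip i _) = 0) ?act0l //; apply: ncpsP => w.
by rewrite /lstrip /ncvar !eqseq_cons andbF.
Qed.

(** The inverse direction: f is transported to the i-th copy of the set of nodes
    and extended by zero to the others. *)
Definition graft_fun (i : 'I_n.+1) (f : node -> k) (o : node) : k :=
  if digit o == i then f (parent o) else 0.

Lemma graft_bounded i (f : lfun) : exists N, vanishes_from (graft_fun i f) N.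
Proof.
have [N fN] := lfun_bounded f; exists N.+1 => o No.
by rewrite /graft_fun; case: ifP => // _; apply: fN => /=; lia.
Qed.

Definition graft_lfun i f : lfun := to_lfun (graft_bounded i f).

Lemma graft_lfunB i : zmod_morphism (graft_lfun i).
Proof.
move=> f g; apply: lfunP => o.
have -> : (graft_lfun i f - graft_lfun i g) o =
          graft_fun i f o - graft_fun i g o by [].
rewrite [LHS]/(graft_fun i (f - g : lfun) o) /graft_fun.
by case: ifP => // _; rewrite subr0.
Qed.

Definition graft (i : 'I_n.+1) : endo lfun := to_endo (graft_lfunB i).

Lemma graftE i f o : graft i f o = if digit o == i then f (parent o) else 0.
Proof. by []. Qed.

Lemma endo_var_graft i j : series_endo (ncvar k i) * graft j = (i == j)%:R.
Proof.
apply: endoP => f; apply: lfunP => o.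
rewrite endo_mulE endo_var graftE digit_child parent_child.
by case: eqP => _.
Qed.

Lemma sum_graft_var : \sum_i graft i * series_endo (ncvar k i) = 1.
Proof.
apply: endoP => f; apply: lfunP => o; rewrite endo_sumE.
have -> : (\sum_i (graft i * series_endo (ncvar k i)) f) o =
          \sum_i (graft i * series_endo (ncvar k i)) f o.
  by elim/big_ind2: _ => // u a v b /= <- <-.
rewrite (bigD1 (digit o)) // big1 => [|i /negPf ni]; last first.
  by rewrite endo_mulE graftE eq_sym ni.
by rewrite endo_mulE graftE eqxx endo_var child_parent [LHS]addr0.
Qed.

Lemma endo_lfun_nontrivial : (1 : endo lfun) <> 0.
Proof.
have dN : exists N, vanishes_from (fun o : node => (o == (0, 0%N))%:R) N.
  by exists 1%N => -[a b] /= a1; case: eqP => // -[]; lia.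
move=> /(congr1 (fun h : endo lfun => h (to_lfun dN) (0, 0%N))) one0.
have /eqP : (1 : k) = 0 by exact: one0.
by rewrite oner_eq0.
Qed.

End SeriesAction.

(** * Inverting the column of variables *)
Section LeavittPairs.
Variable n : nat.

Definition leavitt_pair (T : pzRingType) (x y : 'I_n.+1 -> T) : Prop :=
  (forall i j, x i * y j = (i == j)%:R) /\ \sum_i y i * x i = 1.

Lemma inverts_leavitt_pair (R T : pzRingType) (x : 'I_n.+1 -> R)
    (phi : {rmorphism R -> T}) :
  inverts ((\col_(i < n.+1) x i) : 'M[R]_(n.+1, 1)) phi <->
  exists y, leavitt_pair (phi \o x) y.
Proof.
set X := (X in inverts X _); have XE i j : map_mx phi X i j = phi (x i).
  by rewrite !mxE.
split=> [[g gK Kg] | [y [xy yx]]].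
  pose y j : T := g (delta_mx j 0) 0 0.
  have xy i j : phi (x i) * y j = (i == j)%:R.
    have /colP/(_ i) := Kg (delta_mx j 0).
    by rewrite !mxE big_ord1 XE andbT.
  exists y; split=> //.
  pose u : 'cV[T]_1 := const_mx (\sum_i y i * phi (x i)).
  have : u = const_mx 1.
    apply: (can_inj gK); apply/colP => i; rewrite !mxE !big_ord1 !XE !mxE mulr1.
    rewrite mulr_sumr (bigD1 i) //= big1 => [|j /negPf ji].
      by rewrite mulrA xy eqxx mul1r addr0.
    by rewrite mulrA xy eq_sym ji mul0r.
  by move/colP/(_ 0); rewrite !mxE.
pose Y : 'rV[T]_n.+1 := \row_i y i.
have XY : map_mx phi X *m Y = 1%:M.
  by apply/matrixP => i j; rewrite !mxE big_ord1 XE mxE [LHS]xy.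
have YX : Y *m map_mx phi X = 1%:M.
  apply/matrixP => i j; rewrite !mxE !ord1 eqxx -yx.
  by apply: eq_bigr => l _; rewrite XE mxE.
by exists (mulmx Y) => v; rewrite mulmxA ?XY ?YX mul1mx.
Qed.

End LeavittPairs.

Section Representation.
Variables (k : fieldType) (n : nat) (inR : pred (ncps k 'I_n.+1)).
Variable R : subAlgType inR.

Definition series_op (r : R) : endo (lfun k) := series_endo (val r).

Lemma series_opB : zmod_morphism series_op.
Proof. by move=> r s; rewrite /series_op rmorphB series_endoB. Qed.

Lemma series_op_monoid : monoid_morphism series_op.
Proof.
split=> [|r s]; rewrite /series_op ?rmorph1 ?series_endo1 //.
by rewrite rmorphM series_endoM.
Qed.

HB.instance Definition _ :=
  GRing.isZmodMorphism.Build R (endo (lfun k)) series_op series_opB.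
HB.instance Definition _ :=
  GRing.isMonoidMorphism.Build R (endo (lfun k)) series_op series_op_monoid.

Lemma localization_nontrivial (x : 'I_n.+1 -> R)
    (hx : forall i, \val (x i) = ncvar k i)
    (T : pzRingType) (phi : {rmorphism R -> T}) :
  is_universal_localization ((\col_(i < n.+1) x i) : 'M[R]_(n.+1, 1)) phi ->
  (1 : T) <> 0.
Proof.
case=> _ univ T0; have [|theta _] := univ _ (series_op : {rmorphism R -> _}).
  apply/inverts_leavitt_pair; exists (@graft k n); split=> [i j|].
    by rewrite /= /series_op hx endo_var_graft.
  by under eq_bigr => i _ do rewrite /= /series_op hx; rewrite sum_graft_var.
by apply: (@endo_lfun_nontrivial k); rewrite -(rmorph1 theta) T0 rmorph0.
Qed.

End Representation.

(** * The localization as a union of levels *)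
Section Levels.
Variables (n : nat) (R T : pzRingType) (x : 'I_n.+1 -> R).
Variable phi : {rmorphism R -> T}.
(* For power series: x_i r has no constant term, so each of its words ends with
   some variable x_j. *)
Hypothesis x_mul : forall i r, exists d, x i * r = \sum_j d j * x j.

(** With the y_j at hand, level l is the sum of the y_w phi(R) over the words w
    of length l.  The formulation below does not mention the y_j. *)
Fixpoint level (l : nat) (t : T) : Prop :=
  if l is l'.+1 then forall i, level l' (phi (x i) * t)
  else exists r, t = phi r.

Lemma levelB l t u : level l t -> level l u -> level l (t - u).
Proof.
elim: l t u => [|l IH] t u /=.
  by move=> [r ->] [s ->]; exists (r - s); rewrite rmorphB.
by move=> lt lu i; rewrite mulrBr; apply: IH.
Qed.

Lemma level_phi l r : level l (phi r).
Proof.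
elim: l r => [|l IH] r /=; first by exists r.
by move=> i; rewrite -rmorphM.
Qed.

Lemma levelD l t u : level l t -> level l u -> level l (t + u).
Proof.
move=> lt lu; rewrite -[u]opprK -[- u]sub0r; apply: levelB => //.
by apply: levelB => //; rewrite -(rmorph0 phi); apply: level_phi.
Qed.

Lemma levelS l t : level l t -> level l.+1 t.
Proof.
elim: l t => [|l IH] t; first by move=> [r ->]; apply: level_phi.
by move=> lt i; apply/IH/lt.
Qed.

Lemma level_addl l l' t : level l t -> level (l' + l) t.
Proof. by elim: l' => // l' IH /IH; apply: levelS. Qed.

(** Moving x_i past r costs nothing: x_i r is again a combination of the x_j
    with coefficients on the left. *)
Lemma level_phi_mul l r t : level l t -> level l (phi r * t).
Proof.
elim: l r t => [|l IH] r t.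
  by move=> [s ->]; exists (r * s); rewrite rmorphM.
move=> lt i; rewrite mulrA -rmorphM; have [d ->] := x_mul i r.
rewrite rmorph_sum mulr_suml; elim/big_ind: _ => [||j _].
- by rewrite -(rmorph0 phi); apply: level_phi.
- by move=> u v; apply: levelD.
by rewrite rmorphM -mulrA; apply: IH.
Qed.

Lemma levelM l l' t u : level l t -> level l' u -> level (l + l') (t * u).
Proof.
elim: l t => [|l IH] t; first by move=> [r ->]; apply: level_phi_mul.
by move=> lt lu i; rewrite mulrA; apply: IH.
Qed.

Definition leveled : pred T := fun t => `[< exists l, level l t >].

Lemma leveledP (t : T) : reflect (exists l, level l t) (t \in leveled).
Proof. exact: asboolP. Qed.

Lemma leveled_subring_closed : subring_closed leveled.
Proof.
split=> [|t u /leveledP[l lt] /leveledP[m mu]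
         |t u /leveledP[l lt] /leveledP[m mu]].
- by apply/leveledP; exists 0%N; exists 1; rewrite rmorph1.
- apply/leveledP; exists (l + m)%N; apply: levelB; last exact: level_addl.
  by rewrite addnC; apply: level_addl.
by apply/leveledP; exists (l + m)%N; apply: levelM.
Qed.

HB.instance Definition _ :=
  GRing.isSubringClosed.Build T leveled leveled_subring_closed.

(** A ring type for the elements of some level, in order to apply the universal
    property to it. *)
Record leveled_ring := LeveledRing {
  leveled_val :> T;
  _ : leveled_val \in leveled
}.

HB.instance Definition _ := [isSub for leveled_val].
HB.instance Definition _ := [Choice of leveled_ring by <:].
HB.instance Definition _ :=
  GRing.SubChoice_isSubPzRing.Build T leveled leveled_ring
    leveled_subring_closed.

Lemma phi_leveled r : phi r \in leveled.
Proof. by apply/leveledP; exists 0%N; exists r. Qed.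

Definition phi_corestr (r : R) : leveled_ring := LeveledRing (phi_leveled r).

Lemma phi_corestrB : zmod_morphism phi_corestr.
Proof. by move=> r s; apply: val_inj; rewrite rmorphB /= rmorphB. Qed.

Lemma phi_corestr_monoid : monoid_morphism phi_corestr.
Proof.
split=> [|r s]; apply: val_inj; first by rewrite rmorph1 /= rmorph1.
by rewrite rmorphM /= rmorphM.
Qed.

HB.instance Definition _ :=
  GRing.isZmodMorphism.Build R leveled_ring phi_corestr phi_corestrB.
HB.instance Definition _ :=
  GRing.isMonoidMorphism.Build R leveled_ring phi_corestr phi_corestr_monoid.

(** The elements of all levels form a subring containing the image of R and the
    y_j, so the universal property yields a retraction of T onto it; composed
    with the inclusion it is the identity, again by universality. *)
Lemma localization_leveled :
  is_universal_localization ((\col_(i < n.+1) x i) : 'M[R]_(n.+1, 1)) phi ->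
  forall t, exists l, level l t.
Proof.
case=> /[dup] invT /inverts_leavitt_pair[y [xy yx]] univ t.
have yL j : y j \in leveled.
  apply/leveledP; exists 1%N => i; have /= -> := xy i j.
  by exists (i == j)%:R; rewrite rmorph_nat.
have [|theta [thetaP _]] := univ _ (phi_corestr : {rmorphism R -> _}).
  apply/inverts_leavitt_pair; exists (fun j => LeveledRing (yL j)).
  split=> [i j|]; apply: val_inj.
    by rewrite rmorph_nat -(xy i j) rmorphM.
  rewrite rmorph1 -yx rmorph_sum; apply: eq_bigr => i _.
  by rewrite rmorphM.
have [id' [_ uniq_id]] := univ _ phi invT.
pose incl : {rmorphism leveled_ring -> T} := val.
have E : incl \o theta =1 id'.
  apply: (uniq_id (incl \o theta)) => r /=.
  by have /= -> := thetaP r.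
have Eid : idfun =1 id' by apply: (uniq_id idfun).
have := valP (theta t); rewrite -[val _]/((incl \o theta) t) E -Eid.
by move/leveledP.
Qed.

End Levels.

(** * Stacked columns *)
Section Stacking.
Variable n : nat.

Definition stack_col (T : pzRingType) (x : 'I_n.+1 -> T) m :
    'M[T]_(n.+1 * m, m) :=
  \matrix_(a, k) mxvec (\matrix_(i < n.+1, j < m) (x i *+ (j == k))) 0 a.

Definition stack_row (T : pzRingType) (y : 'I_n.+1 -> T) m :
    'M[T]_(m, n.+1 * m) :=
  \matrix_(k, a) mxvec (\matrix_(i < n.+1, j < m) (y i *+ (j == k))) 0 a.

Lemma mul_stack_col (T : pzRingType) (x : 'I_n.+1 -> T) m p
    (M : 'M_(m, p)) i j l :
  (stack_col x m *m M) (mxvec_index i j) l = x i * M j l.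
Proof.
rewrite mxE (bigD1 j) //= big1 => [|k /negPf kj]; rewrite mxE mxvecE mxE.
  by rewrite eqxx mulr1n addr0.
by rewrite eq_sym kj mulr0n mul0r.
Qed.

Lemma mul_mx_stack_col (T : pzRingType) (x : 'I_n.+1 -> T) m p
    (M : 'M_(p, n.+1 * m)) l k :
  (M *m stack_col x m) l k = \sum_i M l (mxvec_index i k) * x i.
Proof.
pose F i j := M l (mxvec_index i j) * stack_col x m (mxvec_index i j) k.
rewrite mxE (reindex _ (curry_mxvec_bij _ _)) /=.
transitivity (\sum_i \sum_j F i j).
  by rewrite pair_bigA; apply: eq_bigr => -[].
apply: eq_bigr => i _; rewrite (bigD1 k) //= /F big1 => [|j /negPf jk].
  by rewrite mxE mxvecE mxE eqxx mulr1n addr0.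
by rewrite mxE mxvecE mxE jk mulr0n mulr0.
Qed.

Lemma stack_col_row (T : pzRingType) (x y : 'I_n.+1 -> T) m :
  leavitt_pair x y -> stack_col x m *m stack_row y m = 1%:M.
Proof.
case=> xy _; apply/matrixP => a b.
case/mxvec_indexP: a => i j; case/mxvec_indexP: b => i' j'.
rewrite mul_stack_col mxE mxvecE !mxE -mulr_natr mulrA xy -natrM mulnb.
congr (nat_of_bool _)%:R; apply/andP/eqP => [[/eqP-> /eqP->] //|eq_ij].
have [h hK _] := curry_mxvec_bij n.+1 m.
have := hK (i, j) isT; rewrite /= eq_ij => hij.
by have [<- <-] := etrans (esym hij) (hK (i', j') isT).
Qed.

Lemma stack_row_col (T : pzRingType) (x y : 'I_n.+1 -> T) m :
  leavitt_pair x y -> stack_row y m *m stack_col x m = 1%:M.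
Proof.
case=> _ yx; apply/matrixP => k l; rewrite mul_mx_stack_col !mxE.
rewrite -yx -sumrMnl; apply: eq_bigr => i _.
by rewrite mxE mxvecE mxE eq_sym mulrnAl.
Qed.

Lemma map_stack_col (R T : pzRingType) (phi : {rmorphism R -> T})
    (x : 'I_n.+1 -> R) m :
  map_mx phi (stack_col x m) = stack_col (phi \o x) m.
Proof.
apply/matrixP => a k; case/mxvec_indexP: a => i j.
by rewrite !mxE !mxvecE !mxE rmorphMn.
Qed.

Lemma mod_stack m : (n.+1 * m)%N = m %[mod n].
Proof. by rewrite mulSn addnC mulnC modnMDl. Qed.

End Stacking.

(** * Rank factorizations of matrices *)
Section RankFactorizations.
Variables (n : nat) (T : pzRingType).

Definition inverse_mx m p (U : 'M[T]_(m, p)) (V : 'M[T]_(p, m)) : Prop :=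
  U *m V = 1%:M /\ V *m U = 1%:M.

Lemma inverse_mx_sym m p (U : 'M[T]_(m, p)) V :
  inverse_mx U V -> inverse_mx V U.
Proof. by case. Qed.

Lemma inverse_tperm_mx m (i j : 'I_m) :
  inverse_mx (tperm_mx i j : 'M[T]_m) (tperm_mx i j).
Proof. by split; rewrite -perm_mxM tperm2 perm_mx1. Qed.

(** C is the inclusion of a direct summand with retraction C', and N is a free
    complement of it.  Only the class modulo n of the rank of the complement is
    recorded, which is what survives multiplication by an invertible matrix
    whose sizes agree modulo n. *)
Definition complemented m r (C : 'M[T]_(m, r)) (C' : 'M[T]_(r, m)) : Prop :=
  exists a (N : 'M[T]_(m, a)) (N' : 'M[T]_(a, m)),
    [/\ m = r + a %[mod n], C' *m C = 1%:M /\ N' *m N = 1%:M,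
        N' *m C = 0, C' *m N = 0 & C *m C' + N *m N' = 1%:M].

(** M is an isomorphism from a free summand of its source onto a free summand of
    its target, and zero on a free complement.  For the projection B the roles
    of inclusion and retraction are exchanged. *)
Definition rank_factored m p (M : 'M[T]_(m, p)) : Prop :=
  exists r (C : 'M[T]_(m, r)) C' (B : 'M[T]_(r, p)) B',
    [/\ complemented C C', complemented B' B & M = C *m B].

Lemma complemented_mul m p r (C : 'M[T]_(m, r)) C' (U : 'M_(p, m)) V :
  inverse_mx U V -> p = m %[mod n] ->
  complemented C C' -> complemented (U *m C) (C' *m V).
Proof.
case=> UV VU pm [a [N [N' [mra [CC NN] NC CN CN1]]]].
exists a, (U *m N), (N' *m V).
have VUK q (D : 'M_(m, q)) : V *m (U *m D) = D by rewrite mulmxA VU mul1mx.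
split; first by rewrite pm.
- by rewrite -!mulmxA !VUK CC NN.
- by rewrite -mulmxA VUK.
- by rewrite -mulmxA VUK.
by rewrite -!mulmxA -mulmxDr !mulmxA -mulmxDl CN1 mul1mx.
Qed.

Lemma complemented_block m r (C : 'M[T]_(m, r)) C' :
  complemented C C' ->
  complemented (block_mx 1%:M 0 0 C : 'M_(1 + m, 1 + r))
               (block_mx 1%:M 0 0 C' : 'M_(1 + r, 1 + m)).
Proof.
case=> [a [N [N' [mra [CC NN] NC CN CN1]]]].
exists a, (col_mx 0 N), (row_mx 0 N'); split.
- by rewrite -addnA -modnDmr mra modnDmr.
- rewrite mulmx_block mul_row_col CC NN !mul0mx !mulmx0 !mulmx1 !addr0 !add0r.
  by rewrite -scalar_mx_block.
- by rewrite mul_row_block NC !mul0mx !mulmx0 !addr0 row_mx0.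
- by rewrite mul_block_col CN !mul0mx !mulmx0 !addr0 col_mx0.
rewrite mulmx_block mul_col_row !mul0mx !mulmx0 !mulmx1 !addr0 !add0r.
by rewrite add_block_mx !addr0 CN1 -scalar_mx_block.
Qed.

Lemma complemented0 m : complemented (0 : 'M[T]_(m, 0)) 0.
Proof.
exists m, 1%:M, 1%:M; split=> //; rewrite ?mulmx1 ?mul1mx ?mulmx0 ?add0r //.
by split=> //; apply/matrixP => -[].
Qed.

Lemma rank_factored0 m p : rank_factored (0 : 'M[T]_(m, p)).
Proof.
exists 0%N, 0, 0, 0, 0.
by split; [exact: complemented0.. | rewrite mul0mx].
Qed.

Lemma rank_factored_mull m m' p (M : 'M[T]_(m, p)) (U : 'M_(m', m)) V :
  inverse_mx U V -> m' = m %[mod n] ->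
  rank_factored M -> rank_factored (U *m M).
Proof.
move=> UV mm [r [C [C' [B [B' [cC cB ->]]]]]].
exists r, (U *m C), (C' *m V), B, B'.
by split=> //; [exact: complemented_mul | rewrite mulmxA].
Qed.

Lemma rank_factored_mulr m p p' (M : 'M[T]_(m, p)) (U : 'M_(p, p')) V :
  inverse_mx U V -> p' = p %[mod n] ->
  rank_factored M -> rank_factored (M *m U).
Proof.
move=> [UV VU] pp [r [C [C' [B [B' [cC cB ->]]]]]].
exists r, C, C', (B *m U), (V *m B').
by split=> //; [exact: complemented_mul | rewrite mulmxA].
Qed.

Lemma rank_factored_block m p (M : 'M[T]_(m, p)) :
  rank_factored M ->
  rank_factored (block_mx 1%:M 0 0 M : 'M_(1 + m, 1 + p)).
Proof.
case=> [r [C [C' [B [B' [cC cB ->]]]]]].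
exists (1 + r)%N, (block_mx 1%:M 0 0 C), (block_mx 1%:M 0 0 C'),
  (block_mx 1%:M 0 0 B), (block_mx 1%:M 0 0 B').
split; [exact: complemented_block.. |].
by rewrite mulmx_block !mul0mx !mulmx0 !mulmx1 !addr0 !add0r.
Qed.

Lemma mx1_eq0 a : (1 : T) <> 0 -> (1%:M : 'M[T]_a) = 0 -> a = 0%N.
Proof.
by case: a => // a T0 /matrixP/(_ 0 0); rewrite !mxE eqxx => /T0.
Qed.

(** The complements of the image and of the coimage are killed by an invertible
    matrix, so they have rank 0 and both sizes are congruent to r. *)
Lemma rank_factored_invertible m p (M : 'M[T]_(m, p)) (M' : 'M[T]_(p, m)) :
  (1 : T) <> 0 -> rank_factored M -> inverse_mx M M' -> m = p %[mod n].
Proof.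
move=> T0 [r [C [C' [B [B' [cC cB ->]]]]]] [MM' M'M].
case: cC => [a [N [N' [-> [_ NN] NC _ _]]]].
case: cB => [b [K [K' [-> [_ KK] _ BK _]]]].
have N0 : N' = 0.
  by rewrite -[N']mulmx1 -MM' !mulmxA NC !mul0mx.
have K0 : K = 0.
  by rewrite -[K]mul1mx -M'M -!mulmxA BK !mulmx0.
rewrite N0 mul0mx in NN; rewrite K0 mulmx0 in KK.
by rewrite (mx1_eq0 T0 (esym NN)) (mx1_eq0 T0 (esym KK)).
Qed.

End RankFactorizations.

(** * Matrices over the localization have rank factorizations *)
Section SeriesDivision.
Variables (k : fieldType) (n : nat).
Local Notation A := (ncps k 'I_n.+1).

Lemma ncps_mul_var (s : A) i w j :
  (s * ncvar k i) (rcons w j) = s w *+ (i == j).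
Proof.
elim: w s => [|a w IH] s; rewrite [LHS]ncps_mul_cons.
  rewrite ncps_mul_nil [X in _ + X]mulr0 addr0 /ncvar eqseq_cons andbT.
  by rewrite mulr_natr eq_sym.
rewrite [ncvar k i _](_ : _ = 0) ?mulr0 ?add0r; last first.
  by rewrite /ncvar; case: w {IH} => [|b w]; rewrite eqseq_cons andbF.
exact: IH.
Qed.

Lemma ncps_mul_var_nil (s : A) i : (s * ncvar k i) [::] = 0.
Proof. by rewrite [LHS]ncps_mul_nil [X in _ * X](_ : _ = 0) ?mulr0. Qed.

Lemma ncps_sumE I (r : seq I) (F : I -> A) w :
  (\sum_(i <- r) F i) w = \sum_(i <- r) F i w.
Proof. by elim/big_ind2: _ => // u a v b <- <-. Qed.

Lemma ncps_right_division (s : A) :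
  s [::] = 0 -> s = \sum_i ncdelta i s * ncvar k i.
Proof.
move=> s0; apply: ncpsP => w; rewrite ncps_sumE.
case/lastP: w => [|w j].
  by rewrite s0 big1 // => i _; rewrite ncps_mul_var_nil.
rewrite (bigD1 j) //= big1 => [|i /negPf ij]; rewrite ncps_mul_var.
  by rewrite eqxx addr0.
by rewrite ij.
Qed.

End SeriesDivision.

Section LocalSeries.
Variables (k : fieldType) (n : nat) (inR : pred (ncps k 'I_n.+1)).
Variable R : subAlgType inR.
Hypothesis R_local : local_ring R.

Definition const_coef (r : R) : k := (val r : ncps k 'I_n.+1) [::].

Lemma const_coefM r s : const_coef (r * s) = const_coef r * const_coef s.
Proof. by rewrite /const_coef rmorphM [LHS]ncps_mul_nil. Qed.

Lemma const_coef1 : const_coef 1 = 1.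
Proof. by rewrite /const_coef rmorph1. Qed.

(** If r were not a unit, then r and c - r, where c is the constant term of r,
    would both lie in the ideal of nonunits, and so would the unit c. *)
Lemma const_coef_unit r : const_coef r != 0 -> is_unit r.
Proof.
move=> r0; apply: contrapT => nu.
pose c : R := (const_coef r) *: 1.
have cu : is_unit c.
  exists ((const_coef r)^-1 *: 1).
  by rewrite -!scalerAl -!scalerAr !mulr1 !scalerA mulVf ?mulfV // scale1r.
have valc : val c = const_coef r *: (1 : ncps k 'I_n.+1).
  by rewrite /c linearZ /= rmorph1.
have cr0 : const_coef (c - r) = 0.
  have -> : const_coef (c - r) = const_coef c - const_coef r.
    by rewrite /const_coef rmorphB.
  by rewrite {1}/const_coef valc [X in X - _]mulr1 subrr.
have nv : ~ is_unit (c - r).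
  case=> b [/(congr1 const_coef) /eqP]; rewrite const_coefM cr0 const_coef1.
  by rewrite mul0r eq_sym oner_eq0.
by have [_ /(_ _ _ nu nv) + _ _] := R_local; rewrite subrKC.
Qed.

Variable x : 'I_n.+1 -> R.
Hypothesis xE : forall i, \val (x i) = ncvar k i.
Hypothesis R_delta : forall (i : 'I_n.+1) (s : ncps k 'I_n.+1),
  s \in inR -> ncdelta i s \in inR.

Definition rdelta (i : 'I_n.+1) (r : R) : R :=
  @Sub _ inR R (ncdelta i (val r)) (R_delta i (valP r)).

Lemma right_division r : const_coef r = 0 -> r = \sum_i rdelta i r * x i.
Proof.
move=> r0; apply: val_inj; rewrite rmorph_sum [LHS]ncps_right_division //.
by apply: eq_bigr => i _; rewrite rmorphM /= xE SubK.
Qed.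

Lemma var_mul_right_division i r : exists d, x i * r = \sum_j d j * x j.
Proof.
exists (fun j => rdelta j (x i * r)); apply: right_division.
by rewrite const_coefM /const_coef xE [X in X * _](_ : _ = 0) ?mul0r.
Qed.

Variables (T : pzRingType) (phi : {rmorphism R -> T}) (y : 'I_n.+1 -> T).
Hypothesis xy : leavitt_pair (phi \o x) y.

Lemma inverse_stack m :
  inverse_mx (stack_col (phi \o x) m) (stack_row y m).
Proof. by split; [apply: stack_col_row | apply: stack_row_col]. Qed.

Section Pivot.
Variable m : nat.
Hypothesis factor_m : forall p (M : 'M[R]_(m, p)),
  rank_factored n (map_mx phi M).

(** Block elimination, with L lower and U upper triangular:
    M = L diag(1, D') U where D' is the Schur complement of the pivot. *)
Lemma rank_factored_pivot00 p (M : 'M[R]_(1 + m, 1 + p)) :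
  is_unit (M 0 0) -> rank_factored n (map_mx phi M).
Proof.
move=> [b [ab ba]]; pose a := M 0 0.
pose u := ursubmx M; pose l := dlsubmx M; pose D := drsubmx M.
have aE : ulsubmx M = a%:M.
  by apply/matrixP => i j; rewrite !mxE !ord1 eqxx !lshift0.
have aU : (b%:M : 'M[R]_1) *m a%:M = 1%:M by rewrite -scalar_mxM ba.
have aV : (a%:M : 'M[R]_1) *m b%:M = 1%:M by rewrite -scalar_mxM ab.
pose L : 'M[R]_(1 + m) := block_mx 1%:M 0 (l *m b%:M) 1%:M.
pose L' : 'M[R]_(1 + m) := block_mx 1%:M 0 (- (l *m b%:M)) 1%:M.
pose U : 'M[R]_(1 + p) := block_mx a%:M u 0 1%:M.
pose U' : 'M[R]_(1 + p) := block_mx b%:M (- (b%:M *m u)) 0 1%:M.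
pose D' := D - l *m b%:M *m u.
have ME : M = L *m block_mx 1%:M 0 0 D' *m U.
  rewrite /L /U !mulmx_block !(mul0mx, mulmx0, mul1mx, mulmx1, addr0, add0r).
  by rewrite -mulmxA aU mulmx1 subrKC -aE submxK.
have map1 q : map_mx phi (1%:M : 'M_q) = 1%:M by rewrite map_scalar_mx rmorph1.
have invM q (V W : 'M[R]_q) : V *m W = 1%:M -> W *m V = 1%:M ->
    inverse_mx (map_mx phi V) (map_mx phi W).
  by move=> VW WV; split; rewrite -map_mxM ?VW ?WV map1.
have invL : inverse_mx (map_mx phi L) (map_mx phi L').
  apply: invM; rewrite mulmx_block;
    rewrite !(mul0mx, mulmx0, mul1mx, mulmx1, addr0, add0r).
    by rewrite subrr -scalar_mx_block.
  by rewrite addNr -scalar_mx_block.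
have invU : inverse_mx (map_mx phi U) (map_mx phi U').
  apply: invM; rewrite mulmx_block;
    rewrite !(mul0mx, mulmx0, mul1mx, mulmx1, addr0, add0r).
    by rewrite mulmxN mulmxA aV mul1mx addNr -scalar_mx_block.
  by rewrite aU subrr -scalar_mx_block.
rewrite ME !map_mxM; apply: (rank_factored_mulr invU) => //.
apply: (rank_factored_mull invL) => //.
by rewrite map_block_mx !map_mx0 map1; apply: rank_factored_block.
Qed.

Lemma rank_factored_pivot p (M : 'M[R]_(m.+1, p)) i j :
  const_coef (M i j) != 0 -> rank_factored n (map_mx phi M).
Proof.
case: p M j => [|p] M j; first by case: j.
move=> /const_coef_unit Mu; pose M' := xrow i 0 (xcol j 0 M).
have -> : map_mx phi M = tperm_mx i 0 *m (map_mx phi M') *m tperm_mx j 0.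
  rewrite /M' map_xrow map_xcol xrowE xcolE !mulmxA -perm_mxM tperm2 perm_mx1.
  by rewrite mul1mx -mulmxA -perm_mxM tperm2 perm_mx1 mulmx1.
apply: (rank_factored_mulr (inverse_tperm_mx _ _ _)) => //.
apply: (rank_factored_mull (inverse_tperm_mx _ _ _)) => //.
by apply: rank_factored_pivot00; rewrite !mxE !tpermR.
Qed.

(** Induction on a word w of the support of some entry, read from the right:
    without a pivot, M = B X_p and the entry of B that corresponds to the last
    letter v of w has the shorter word in its support. *)
Lemma rank_factored_word w p (M : 'M[R]_(m.+1, p)) i j :
  (val (M i j) : ncps k 'I_n.+1) w != 0 -> rank_factored n (map_mx phi M).
Proof.
elim/last_ind: w p M j => [|w v IHw] p M j; first exact: rank_factored_pivot.
have [[a [b]]|no_pivot] := pselect (exists a b, const_coef (M a b) != 0).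
  by move=> /rank_factored_pivot.
have M0 a b : const_coef (M a b) = 0.
  by apply/eqP/negP => Mab; apply: no_pivot; exists a, b; apply/negP.
pose B : 'M[R]_(m.+1, n.+1 * p) :=
  \matrix_(a, c) mxvec (\matrix_(i, b) rdelta i (M a b)) 0 c.
have BE a c b : B a (mxvec_index c b) = rdelta c (M a b).
  by rewrite mxE mxvecE mxE.
have ME : M = B *m stack_col x p.
  apply/matrixP => a b; rewrite mul_mx_stack_col [LHS]right_division //.
  by apply: eq_bigr => c _; rewrite BE.
move=> Mw; rewrite ME map_mxM map_stack_col.
apply: (rank_factored_mulr (inverse_stack _)); first by rewrite mod_stack.
apply: (IHw _ _ (mxvec_index v j)); rewrite BE SubK; exact: Mw.
Qed.

End Pivot.

Lemma rank_factored_map m p (M : 'M[R]_(m, p)) : rank_factored n (map_mx phi M).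
Proof.
elim: m p M => [|m IH] p M.
  by rewrite (flatmx0 (map_mx _ _)); apply: rank_factored0.
have [[i [j [w]]]|noM] := pselect (exists i j w,
    (val (M i j) : ncps k 'I_n.+1) w != 0).
  exact: rank_factored_word.
have -> : M = 0; last by rewrite map_mx0; apply: rank_factored0.
apply/matrixP => i j; rewrite mxE; apply: val_inj; rewrite rmorph0.
apply: ncpsP => w; apply/eqP/negP => Mw.
by apply: noM; exists i, j, w; apply/negP.
Qed.

Hypothesis levelT : forall t, exists l, level x phi l t.

(** Left multiplication by X_m lowers the level of all entries by one. *)
Lemma rank_factored_level l m p (M : 'M[T]_(m, p)) :
  (forall i j, level x phi l (M i j)) -> rank_factored n M.
Proof.
elim: l m M => [|l IH] m M Ml.
  have -> : M = map_mx phi (\matrix_(i, j) projT1 (cid (Ml i j))).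
    by apply/matrixP => i j; rewrite !mxE; case: cid.
  exact: rank_factored_map.
rewrite -[M]mul1mx -(stack_row_col _ xy) -mulmxA.
apply: (rank_factored_mull (inverse_mx_sym (inverse_stack _))).
  by rewrite mod_stack.
apply: IH => a j; case/mxvec_indexP: a => i a.
by rewrite mul_stack_col; apply: Ml.
Qed.

(** A level common to all entries is given by the sum of their levels. *)
Lemma rank_factored_all m p (M : 'M[T]_(m, p)) : rank_factored n M.
Proof.
pose l i j := projT1 (cid (levelT (M i j))).
apply: (@rank_factored_level (\sum_i \sum_j l i j)) => i j.
rewrite (bigD1 i) //= (bigD1 j) //= -addnA addnC; apply: level_addl.
by rewrite /l; case: cid.
Qed.

End LocalSeries.

(** * Free and projective modules *)
Section Modules.
Variable A : pzRingType.
Implicit Types P Q S : lmodType A.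

Definition to_linear P Q (f : P -> Q) (lf : linear f) : {linear P -> Q} :=
  HB.pack f (GRing.isLinear.Build A P Q *:%R f lf).

Lemma lmod_iso_intro P Q (f : P -> Q) (g : Q -> P) :
  linear f -> cancel f g -> cancel g f -> lmod_isomorphic P Q.
Proof. by move=> lf fK gK; exists (to_linear lf); exists g. Qed.

Lemma lmod_iso_refl P : lmod_isomorphic P P.
Proof. by apply: (@lmod_iso_intro _ _ id id). Qed.

Lemma lmod_iso_sym P Q : lmod_isomorphic P Q -> lmod_isomorphic Q P.
Proof.
case=> f [g fK gK]; apply: (@lmod_iso_intro _ _ g f) => //.
by move=> a u v; apply: (can_inj fK); rewrite linearP !gK.
Qed.

Lemma lmod_iso_trans P Q S :
  lmod_isomorphic P Q -> lmod_isomorphic Q S -> lmod_isomorphic P S.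
Proof.
case=> f [f' fK f'K] [g [g' gK g'K]].
apply: (@lmod_iso_intro _ _ (g \o f) (f' \o g')).
- by move=> a u v; rewrite /= !linearP.
- exact: can_comp.
- exact: can_comp.
Qed.

Lemma lmod_iso_prod P P' Q Q' : lmod_isomorphic P P' -> lmod_isomorphic Q Q' ->
  lmod_isomorphic (P * Q)%type (P' * Q')%type.
Proof.
case=> f [f' fK f'K] [g [g' gK g'K]].
apply: (@lmod_iso_intro _ _ (fun u => (f u.1, g u.2))
                            (fun u => (f' u.1, g' u.2))).
- by move=> a u v; rewrite /= !linearP.
- by case=> u v; rewrite /= fK gK.
- by case=> u v; rewrite /= f'K g'K.
Qed.

Lemma rowvec_iso_of_mx a b (U : 'M[A]_(a, b)) V :
  inverse_mx U V -> lmod_isomorphic 'rV[A]_a 'rV[A]_b.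
Proof.
case=> UV VU; apply: (@lmod_iso_intro _ _ (fun u => u *m U) (fun u => u *m V)).
- by move=> c u v; rewrite mulmxDl scalemxAl.
- by move=> u; rewrite -mulmxA UV mulmx1.
- by move=> u; rewrite -mulmxA VU mulmx1.
Qed.

Lemma rowvec_iso_to_mx a b : lmod_isomorphic 'rV[A]_a 'rV[A]_b ->
  exists (U : 'M[A]_(a, b)) V, inverse_mx U V.
Proof.
move=> /[dup] /lmod_iso_sym [g _] [f [g' fK g'K]].
have lg : linear g' by move=> c u v; apply: (can_inj fK); rewrite linearP !g'K.
pose h := to_linear lg.
exists (lin1_mx f), (lin1_mx h); split; apply/row_matrixP => i;
  by rewrite !rowE mulmxA !mul_rV_lin1 /= ?fK ?g'K mulmx1.
Qed.

Lemma rowvec_prod a b :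
  lmod_isomorphic ('rV[A]_a * 'rV[A]_b)%type 'rV[A]_(a + b).
Proof.
apply: (@lmod_iso_intro _ _ (fun u => row_mx u.1 u.2)
                            (fun u => (lsubmx u, rsubmx u))).
- by move=> c u v; rewrite /= scale_row_mx add_row_mx.
- by case=> u v; rewrite /= row_mxKl row_mxKr.
- by move=> u; rewrite /= hsubmxK.
Qed.

Lemma rowvec1 : lmod_isomorphic A^o 'rV[A]_1.
Proof.
apply: (@lmod_iso_intro _ _ (fun a : A^o => const_mx a : 'rV[A]_1)
                            (fun u => u 0 0)).
- by move=> c u v; apply/rowP => j; rewrite !mxE.
- by move=> u; rewrite mxE.
- by move=> u; apply/rowP => j; rewrite mxE ord1.
Qed.

Definition lin_comb P m (g : 'I_m -> P) (u : 'rV[A]_m) : P :=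
  \sum_i u 0 i *: g i.

Lemma lin_comb_linear P m (g : 'I_m -> P) : linear (lin_comb g).
Proof.
move=> c u v; rewrite scaler_sumr -big_split; apply: eq_bigr => i _.
by rewrite !mxE scalerDl scalerA.
Qed.

Lemma lin_comb_delta m (u : 'rV[A]_m) : lin_comb (delta_mx 0) u = u.
Proof. by rewrite [RHS]row_sum_delta. Qed.

Lemma rowvec_fg m : finitely_generated 'rV[A]_m.
Proof.
exists m, (delta_mx 0) => u; exists (u 0); exact: (esym (lin_comb_delta u)).
Qed.

Lemma rowvec_projective m : projective 'rV[A]_m.
Proof.
move=> M N p f psurj.
pose g i := projT1 (cid (psurj (f (delta_mx 0 i)))).
have pg i : p (g i) = f (delta_mx 0 i) by rewrite /g; case: cid.
exists (to_linear (lin_comb_linear g)) => u.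
rewrite -[u in RHS]lin_comb_delta /= /lin_comb !linear_sum.
by apply: eq_bigr => i _; rewrite !linearZ /= pg.
Qed.

Definition free_module m : fgProj A :=
  FgProj (rowvec_fg m) (@rowvec_projective m).

(** The module is the image of an idempotent E = C B; from E E = E, C' C = 1 and
    B B' = 1 one gets B C = C' E E B' = C' E B' = 1, so that B and C identify
    this image with the row vectors of length r. *)
Lemma fgProj_free (P : fgProj A) :
  (forall m (E : 'M[A]_m), exists r (C : 'M_(m, r)) C' (B : 'M_(r, m)) B',
     [/\ C' *m C = 1%:M, B *m B' = 1%:M & E = C *m B]) ->
  exists r, lmod_isomorphic P 'rV[A]_r.
Proof.
case: P => P Pfg Pproj /= factor.
case: Pfg => m [g gen]; pose p := to_linear (lin_comb_linear g).
have psurj v : exists u, p u = v.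
  have [c ->] := gen v; exists (\row_i c i).
  by rewrite /= /lin_comb; apply: eq_bigr => i _; rewrite mxE.
have [h ph] := Pproj _ _ p idfun psurj.
pose E := lin1_mx (h \o p); have uE u : u *m E = h (p u) by rewrite mul_rV_lin1.
have [r [C [C' [B [B' [CC BB ECB]]]]]] := factor m E.
have EE : E *m E = E.
  by apply/row_matrixP => i; rewrite !rowE mulmxA !uE [p (h _)]ph.
have BC : B *m C = 1%:M.
  have -> : B *m C = C' *m (E *m E) *m B'.
    by rewrite ECB !mulmxA CC mul1mx -mulmxA BB mulmx1.
  by rewrite EE ECB mulmxA CC mul1mx BB.
exists r; apply: (@lmod_iso_intro _ _ (fun v => h v *m C)
                                      (fun u => p (u *m B))).
- by move=> c u v; rewrite linearP mulmxDl scalemxAl.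
- by move=> v; rewrite -mulmxA -ECB uE [p (h _)]ph [p (h _)]ph.
by move=> u; rewrite -uE ECB !mulmxA -(mulmxA u) BC mulmx1 -mulmxA BC mulmx1.
Qed.

End Modules.

(** * The Grothendieck group *)
Section K0OfFree.
Variables (A : pzRingType) (G : zmodType) (cls : fgProj A -> G).

Lemma cls_free r (P : fgProj A) : additive_invariant cls ->
  lmod_isomorphic P 'rV[A]_r -> cls P = cls (fgProj_regular A) *+ r.
Proof.
case=> cls_iso clsD; elim: r P => [|r IH] P isoP.
  (* a zero module P is isomorphic to P * P *)
  apply: (addrI (cls P)); rewrite -(clsD P P P) ?addr0 //.
  apply: (lmod_iso_trans isoP).
  apply: (lmod_iso_trans (lmod_iso_sym (rowvec_prod A 0 0))).
  by apply: lmod_iso_prod; apply: lmod_iso_sym.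
rewrite (clsD (fgProj_regular A) (free_module A r)).
  by rewrite mulrS (IH (free_module A r)) //; apply: lmod_iso_refl.
apply: (lmod_iso_trans isoP).
apply: (lmod_iso_trans (lmod_iso_sym (rowvec_prod A 1 r))).
by apply: lmod_iso_prod; [apply/lmod_iso_sym/rowvec1 | apply: lmod_iso_refl].
Qed.

(** The rank modulo n is a well defined additive invariant, hence induces theta
    from K0 to Z/n.  In the other direction i |-> c *+ i is additive because
    c *+ n = 0.  The composite on K0 fixes all classes, so it is the identity by
    the uniqueness part of the universal property, and the composite on Z/n
    fixes the generator. *)
Lemma K0_cyclic n : (0 < n)%N -> is_K0 cls ->
  (forall P : fgProj A, exists r, lmod_isomorphic P 'rV[A]_r) ->
  lmod_isomorphic 'rV[A]_1 'rV[A]_n.+1 ->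
  (forall a b, lmod_isomorphic 'rV[A]_a 'rV[A]_b -> a = b %[mod n]) ->
  cyclic_of_order_generated_by n (cls (fgProj_regular A)).
Proof.
case: n => // n _ [cls_inv univ] free iso_n ibn; set c := cls _.
have cn : c *+ n.+1 = 0.
  apply: (addrI c); rewrite -mulrS addr0.
  rewrite -(cls_free cls_inv (lmod_iso_refl (free_module A n.+2))).
  rewrite -[RHS]mulr1n -(cls_free cls_inv (lmod_iso_refl (free_module A 1))).
  by apply: cls_inv.1; apply: lmod_iso_sym.
have cmod r : c *+ (r %% n.+1) = c *+ r.
  by rewrite [in RHS](divn_eq r n.+1) mulrnDr mulnC mulrnA cn mul0rn add0r.
pose rk P := projT1 (cid (free P)).
have rkP (P : fgProj A) : lmod_isomorphic P 'rV[A]_(rk P).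
  by rewrite /rk; case: cid.
have rkE (P : fgProj A) r : lmod_isomorphic P 'rV[A]_r -> rk P = r %[mod n.+1].
  by move=> iso; apply/ibn/(lmod_iso_trans _ iso)/lmod_iso_sym.
pose h P : 'I_n.+1 := inZp (rk P).
have h_inv : additive_invariant h.
  split=> [P Q isoPQ|P Q S isoS]; apply: val_inj => /=.
    by apply/rkE/(lmod_iso_trans isoPQ).
  rewrite modnDm; apply/rkE/(lmod_iso_trans isoS).
  by apply: (lmod_iso_trans _ (rowvec_prod _ _ _)); apply: lmod_iso_prod.
have [theta [thetaP _]] := univ _ h h_inv.
have sB : zmod_morphism (fun i : 'I_n.+1 => c *+ i).
  move=> i j /=; rewrite cmod mulrnDr cmod; congr (_ + _).
  by apply: (addrI (c *+ j)); rewrite -mulrnDr subnKC ?cn ?subrr // ltnW.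
pose s : {additive 'I_n.+1 -> G} :=
  HB.pack (fun i : 'I_n.+1 => c *+ i)
    (GRing.isZmodMorphism.Build 'I_n.+1 G (fun i : 'I_n.+1 => c *+ i) sB).
have [id' [_ uniq_id]] := univ _ cls cls_inv.
have s_theta : s \o theta =1 id'.
  apply: (uniq_id (s \o theta)) => P /=; have /= -> := thetaP P.
  by rewrite /= cmod (cls_free cls_inv (rkP P)).
have id_id' : idfun =1 id' by apply: (uniq_id idfun).
have thetaK : cancel theta s.
  by move=> g; rewrite -[LHS]/((s \o theta) g) s_theta -id_id'.
split=> [g|]; first by exists (theta g)%:Z; rewrite -[LHS]thetaK.
exists s; exists theta => // i; have /= := thetaP (fgProj_regular A).
rewrite -/c => theta_c; rewrite /= raddfMn /= theta_c.
apply: val_inj; rewrite [_ *+ _]Zp_mulrn /= modnMml.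
have -> : (rk (fgProj_regular A) * i = 1 * i %[mod n.+1])%N.
  by rewrite -modnMml (rkE _ 1%N) ?modnMml //; apply: rowvec1.
by rewrite mul1n modn_small.
Qed.

End K0OfFree.

(** * Passing to the converse ring *)
Section Converse.
Variable T : pzRingType.

Lemma trmx_mul_conv m n p (A : 'M[T^c]_(m, n)) (B : 'M[T^c]_(n, p)) :
  (A *m B)^T = (B^T : 'M[T]_(p, n)) *m (A^T : 'M[T]_(n, m)).
Proof. by apply/matrixP=> k i /[!mxE]; apply: eq_bigr => j _ /[!mxE]. Qed.

Lemma inverse_mx_conv m n (U : 'M[T^c]_(m, n)) V :
  inverse_mx U V -> inverse_mx (V^T : 'M[T]_(m, n)) (U^T : 'M[T]_(n, m)).
Proof. by case=> UV VU; split; rewrite -trmx_mul_conv ?UV ?VU trmx1. Qed.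

Lemma inverse_mx_to_conv m n (U : 'M[T]_(m, n)) V :
  inverse_mx U V -> inverse_mx (V^T : 'M[T^c]_(m, n)) (U^T : 'M[T^c]_(n, m)).
Proof. by case=> UV VU; split; rewrite -trmx_mul_rev ?UV ?VU trmx1. Qed.

Lemma rank_factored_conv n m p (E : 'M[T^c]_(m, p)) :
  rank_factored n (E^T : 'M[T]_(p, m)) ->
  exists r (C : 'M[T^c]_(m, r)) C' (B : 'M[T^c]_(r, p)) B',
     [/\ C' *m C = 1%:M, B *m B' = 1%:M & E = C *m B].
Proof.
case=> r [C [C' [B [B' [[_ [_ [_ [_ [CC _] _ _ _]]]] cB E_CB]]]]].
case: cB => [_ [_ [_ [_ [BB _] _ _ _]]]].
exists r, B^T, B'^T, C^T, C'^T.
split; [by rewrite -trmx_mul_rev BB trmx1 | by rewrite -trmx_mul_rev CC trmx1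
       |].
by rewrite -trmx_mul_rev -E_CB trmxK.
Qed.

End Converse.

Theorem theorem5p6 (k : fieldType) (n : nat) (hn : (1 <= n)%N)
  (inR : pred (ncps k 'I_n.+1)) (R : subAlgType inR)
  (hpoly : forall s : ncps k 'I_n.+1, is_ncpoly s -> s \in inR)
  (hlocal : local_ring R)
  (hdelta : forall (i : 'I_n.+1) (s : ncps k 'I_n.+1),
     s \in inR -> ncdelta i s \in inR)
  (x : 'I_n.+1 -> R) (hx : forall i, \val (x i) = ncvar k i)
  (T : pzRingType) (phi : {rmorphism R -> T})
  (hT : is_universal_localization
          ((\col_(i < n.+1) x i) : 'M[R]_(n.+1, 1)) phi)
  (K0T : zmodType) (cls : fgProj T^c -> K0T) (hK0 : is_K0 cls) :
  cyclic_of_order_generated_by n (cls (fgProj_regular T^c)).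
Proof.
have [y xy] := (inverts_leavitt_pair x phi).1 hT.1.
have levelT := localization_leveled (var_mul_right_division hx hdelta) hT.
have factorT m p (M : 'M[T]_(m, p)) : rank_factored n M.
  exact: (rank_factored_all hlocal hx hdelta xy levelT).
have T0 := localization_nontrivial hx hT.
apply: K0_cyclic hn hK0 _ _ _ => [P||a b].
- by apply: fgProj_free => m E; apply: (rank_factored_conv (factorT _ _ _)).
- have := inverse_mx_to_conv (inverse_mx_sym (inverse_stack xy 1)).
  by move/rowvec_iso_of_mx; rewrite muln1.
move=> /rowvec_iso_to_mx[U [V /inverse_mx_conv UV]].
exact: rank_factored_invertible T0 (factorT _ _ _) UV.
Qed.
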